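(* Assume the bounded inverse assumption and the lifted regularity assumption (both stated in the context). Let $F:\mathcal D\to L^2(\Omega\times\Omega)$ be the parameter-to-covariance map $F(\theta)=\mathrm{Cov}_J(\mathbf S(\theta),\mathbf S(\theta))$. Let $\tilde\theta\in\widehat{\mathcal D}$ and $\rho>0$ with $\mathcal B^{\widehat X}_\rho(\tilde\theta)\subseteq\widehat{\mathcal D}$. Then there are positive constants $$\widehat M=\widehat M(\|\tilde\theta\|_{\widehat X},\rho),\qquad \widehat N=\widehat N(\|\tilde\theta\|_{\widehat X},\rho,\|\Pi_f\|_{\mathcal{HS}(W,W^* )})$$ such that the first order linearization error $$E_{\mathrm{lin}}:=\|F(\theta)-F(\tilde\theta)-F'(\theta)(\theta-\tilde\theta)\|_{L^2(\Omega\times\Omega)}$$ satisfies $$E_{\mathrm{lin}}\le \widehat M\,\|\theta-\tilde\theta\|_{\widehat X}\,\|F(\theta)-F(\tilde\theta)\|_{L^2(\Omega\times\Omega)}+\widehat N\,\|\theta-\tilde\theta\|_X\,\|\theta-\tilde\theta\|_{\widehat X}$$ for all $\theta\in\mathcal B^{\widehat X}_\rho(\tilde\theta)$.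
   Context: Setting. $\Omega$ is a smooth domain. $X$ is a real Hilbert space (parameters), $U$ and $W$ are complex Hilbert spaces of functions on $\Omega$, with Gelfand triples $U\hookrightarrow L^2(\Omega)\hookrightarrow U^*$, $W\hookrightarrow L^2(\Omega)\hookrightarrow W^*$ (dense continuous embeddings, $L^2(\Omega)=L^2(\Omega;\mathbb C)$). The PDE model is affine bilinear: $D(\theta)u:=Ku+B(u)\theta$ with $K\in\mathcal L(U,W^* )$, $B\in\mathcal L(U,\mathcal L(X,W^* ))$. On a domain $\mathcal D\subseteq X$, $D(\theta)\in\mathcal L(U,W^* )$ is boundedly invertible, $D(\theta)^{-1}\in\mathcal L(W^*,U)$. Sources $f_1,\dots,f_J\in W^*$ are fixed, $S_{f_j}(\theta)=D(\theta)^{-1}f_j\in U$, and $\mathbf S(\theta)=(S_{f_1}(\theta),\dots,S_{f_J}(\theta))\in U^J$. For $u,v\in U^J$, $\mathrm{Cov}_J(u,v)(x,x'):=\frac1J\sum_{j=1}^J u_j(x)\overline{v_j(x')}$. $F'(\theta)$ is the Fréchet derivative: $F'(\theta)h=\mathrm{Cov}_J(u,\phi)+\mathrm{Cov}_J(\phi,u)$ with $u=\mathbf S(\theta)$, $\phi=(\phi_j)$, $D(\theta)\phi_j=-B(u_j)h$. $\Pi_f:=\mathrm{Cov}_J(f,f)\in\mathcal{HS}(W,W^* )$ is the source sample covariance operator $\varphi\mapsto\frac1J\sum_j\langle\varphi,f_j\rangle_{W,W^*}f_j$; $\mathcal{HS}$ denotes Hilbert–Schmidt operators. $\mathcal B^{Z}_\rho(\tilde\theta)$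 is the ball in $Z$ centered at $\tilde\theta$ of radius $\rho$. Bounded inverse assumption: there is $\pi:\mathbb R^+\to\mathbb R^+$ mapping bounded sets to bounded sets with $\|D(\theta)^{-1}\|_{W^*\to U}\le\pi(\|\theta\|_X)$ for any $\theta\in\mathcal D$. Lifted regularity assumption: there are Hilbert spaces $\widehat U\subseteq U$ and $\widehat X\hookrightarrow X$ with the Gelfand triple property (in particular $\widehat U\hookrightarrow L^2(\Omega)\hookrightarrow\widehat U^*$) such that (i) $D(\theta)\in\mathcal L(\widehat U,L^2(\Omega))$ for all $\theta\in\widehat X$, $B\in\mathcal L(\widehat U,\mathcal L(\widehat X,L^2(\Omega)))$, and $D(\theta)^{-1}\in\mathcal L(L^2(\Omega),\widehat U)$ for all $\theta\in\widehat{\mathcal D}:=\mathcal D\cap\widehat X$; (ii) there is $\widehat\pi:\mathbb R^+\to\mathbb R^+$ mapping bounded sets to bounded sets with $\|D(\theta)^{-1}\|_{L^2\to\widehat U}\le\widehat\pi(\|\theta\|_{\widehat X})$ for any $\theta\in\widehat{\mathcal D}$. The norm on $\widehat X$ is chosen such that $\|\cdot\|_X\le\|\cdot\|_{\widehat X}$. Constants may also depend on the fixed model (spaces, embeddings, $K$, $B$, $\pi$, $\widehat\pi$). *)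

(* Defs.v *)
From HB Require Import structures.
From mathcomp Require Import all_boot all_order all_algebra.
From mathcomp Require Import complex ring.
From mathcomp Require Import all_classical all_reals all_analysis.

Set Implicit Arguments.
Unset Strict Implicit.
Unset Printing Implicit Defensive.

Import Order.TTheory GRing.Theory Num.Theory.
Import numFieldNormedType.Exports.

Local Open Scope classical_set_scope.
Local Open Scope ring_scope.

(* R^n is 'rV[R]_n with its normed topology.  Its sigma-algebra is the product
   (= Borel) one generated by the coordinates, and Lebesgue measure is the
   n-fold product of the Lebesgue measure on R. *)
Section measurable_rV.
Variables (R : realType) (n : nat).

Let coord (i : 'I_n) (x : 'rV[R]_n) : R := x ord0 i.

Let rV_set0 : g_sigma_preimage coord set0.
Proof. exact: sigma_algebra0. Qed.

Let rV_setC A : g_sigma_preimage coord A -> g_sigma_preimage coord (~` A).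
Proof. exact: sigma_algebraC. Qed.

Let rV_bigcup (F : _^nat) : (forall i, g_sigma_preimage coord (F i)) ->
  g_sigma_preimage coord (\bigcup_i (F i)).
Proof. exact: sigma_algebra_bigcup. Qed.

HB.instance Definition _ := @isMeasurable.Build default_measure_display
  'rV[R]_n (g_sigma_preimage coord) rV_set0 rV_setC rV_bigcup.

Lemma measurable_coord (i : 'I_n) :
  measurable_fun [set: 'rV[R]_n] (fun x : 'rV[R]_n => x ord0 i).
Proof.
move=> _ Y mY; rewrite setTI; apply: sub_sigma_algebra => /=.
rewrite -bigcup_seq/=; exists i => /=; first by rewrite mem_index_enum.
by exists Y => //; rewrite setTI.
Qed.

Lemma measurable_fun_rV d (T : measurableType d) (f : T -> 'rV[R]_n) :
  (forall i, measurable_fun [set: T] (fun x => f x ord0 i)) ->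
  measurable_fun [set: T] f.
Proof.
move=> mf; suff : g_sigma_preimage (fun i => coord i \o f) `<=` measurable.
  by rewrite g_sigma_preimage_comp => prefS _ A mA; apply: prefS; exists A.
apply: smallest_sub; first exact: sigma_algebra_measurable.
rewrite -bigcup_seq; apply: bigcup_sub => i _ _ [B mB <-].
exact: mf.
Qed.

End measurable_rV.

Section lebesgue_measure_rV.
Variable R : realType.

Definition row_cons n (p : measurableTypeR R * 'rV[R]_n) : 'rV[R]_n.+1 :=
  \row_i (if unlift ord0 i is Some j then p.2 ord0 j else p.1).

Definition row_uncons n (v : 'rV[R]_n.+1) : measurableTypeR R * 'rV[R]_n :=
  (v ord0 ord0, \row_j v ord0 (lift ord0 j)).

Lemma row_unconsK n : cancel (@row_uncons n) (@row_cons n).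
Proof.
move=> v; apply/rowP => i; rewrite mxE /=.
by case: unliftP => [j ->|->]; rewrite ?mxE.
Qed.

Lemma row_consK n : cancel (@row_cons n) (@row_uncons n).
Proof.
move=> [x v]; rewrite /row_uncons mxE unlift_none; congr pair.
by apply/rowP => j; rewrite !mxE liftK.
Qed.

Lemma measurable_row_cons n : measurable_fun setT (@row_cons n).
Proof.
apply: measurable_fun_rV => i; under eq_fun do rewrite mxE.
case: unliftP => [j _|_]; last exact: measurable_fst.
exact: (measurableT_comp (measurable_coord j) measurable_snd).
Qed.

Lemma measurable_row_uncons n : measurable_fun setT (@row_uncons n).
Proof.
apply/measurable_fun_pairP; split; first exact: measurable_coord.
apply: measurable_fun_rV => i /=; under eq_fun do rewrite mxE.
exact: measurable_coord.
Qed.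

Section row_cons_measure.
Variables (n : nat) (mu : {sigma_finite_measure set 'rV[R]_n -> \bar R}).

Definition row_cons_measure : set 'rV[R]_n.+1 -> \bar R :=
  pushforward (@lebesgue_measure R \x mu)%E (@row_cons n).

Let row_cons_measure_semi_sigma_additive :
  semi_sigma_additive row_cons_measure.
Proof.
exact: (@measure_semi_sigma_additive _ _ _
  (measure_function_pushforward__canonical__measure_function_Measure
    (@lebesgue_measure R \x mu)%E (@measurable_row_cons n))).
Qed.

HB.instance Definition _ := isMeasure.Build _ _ _ row_cons_measure
  (measure0 (@lebesgue_measure R \x mu)%E)
  (fun=> measure_ge0 (@lebesgue_measure R \x mu)%E _)
  row_cons_measure_semi_sigma_additive.

Let row_cons_measure_sigma_finite : sigma_finite setT row_cons_measure.
Proof.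
have /sigma_finiteP[F [FT ndF Foo]] := sigma_finiteT (@lebesgue_measure R).
have /sigma_finiteP[G [GT ndG Goo]] := sigma_finiteT mu.
exists (fun k => @row_uncons n @^-1` (F k `*` G k)).
  rewrite -preimage_bigcup (_ : \bigcup_k _ = setT) ?preimage_setT//.
  rewrite -subTset => -[x v] _.
  have [k _ Fkx] : (\bigcup_k F k) x by rewrite -FT.
  have [l _ Glv] : (\bigcup_k G k) v by rewrite -GT.
  exists (maxn k l) => //; split => /=.
  - by move: x Fkx; exact/subsetPset/ndF/leq_maxl.
  - by move: v Glv; exact/subsetPset/ndG/leq_maxr.
move=> k; have [mF Fk] := Foo k; have [mG Gk] := Goo k; split.
  rewrite -[X in measurable X]setTI.
  by apply: measurable_row_uncons => //; exact: measurableX.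
rewrite /row_cons_measure /pushforward -comp_preimage (_ : _ \o _ = id).
  by rewrite preimage_id product_measure1E// lte_mul_pinfty// ge0_fin_numE.
by apply/funext => p /=; rewrite row_consK.
Qed.

HB.instance Definition _ := @Measure_isSigmaFinite.Build _ _ _
  row_cons_measure row_cons_measure_sigma_finite.

End row_cons_measure.

Definition dirac_rV0 : set 'rV[R]_0 -> \bar R := \d_(0 : 'rV[R]_0).
HB.instance Definition _ := Measure.on dirac_rV0.

Let dirac_rV0_sigma_finite : sigma_finite setT dirac_rV0.
Proof.
apply: fin_num_fun_sigma_finite; first by rewrite measure0.
by move=> A _; rewrite /dirac_rV0 diracE.
Qed.

HB.instance Definition _ := @Measure_isSigmaFinite.Build _ _ _
  dirac_rV0 dirac_rV0_sigma_finite.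

Fixpoint lebesgue_rV n : {sigma_finite_measure set 'rV[R]_n -> \bar R} :=
  if n is n'.+1 then row_cons_measure (lebesgue_rV n') else dirac_rV0.

End lebesgue_measure_rV.

Section smooth_domain.
Variables (R : realType) (n : nat).

Definition smooth (f : 'rV[R]_n.+1 -> R) : Prop :=
  forall vs : seq 'rV[R]_n.+1,
    let g := foldr (fun v h => 'D_v h) f vs in
    continuous g /\ forall x v, derivable g x v.

Definition smooth_domain (Omega : set 'rV[R]_n.+1) : Prop :=
  [/\ open Omega, connected Omega, Omega !=set0 &
      forall p, (closure Omega `\` Omega) p ->
        exists psi : 'rV[R]_n.+1 -> R,
          [/\ smooth psi, (exists v, 'D_v psi p != 0) &
              \forall x \near p, Omega x <-> psi x < 0]].

End smooth_domain.

(* Elements of L^2 are represented by functions, of which only the values on D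
   matter; no quotient is taken, so identities between elements of L^2 are
   stated almost everywhere. *)
Section L2.
Context {d : measure_display} {T : measurableType d} {R : realType}.
Variables (mu : {measure set T -> \bar R}) (D : set T).

Definition L2norm (f : T -> R[i]) : \bar R :=
  'N[mu]_2%:E[(fun x => (Normc.normc (f x))%:E) \_ D]%E.

Definition in_L2 (f : T -> R[i]) : Prop :=
  [/\ measurable_fun D (fun x => complex.Re (f x)),
      measurable_fun D (fun x => complex.Im (f x)) &
      (L2norm f < +oo)%E].

Definition L2inner (f g : T -> R[i]) : R[i] :=
  Complex (\int[mu]_(x in D) complex.Re (f x * (g x)^*))
          (\int[mu]_(x in D) complex.Im (f x * (g x)^*)).

End L2.

Section hilbert.
Context {R : realType}.

Definition normR {V : normedModType R[i]} (v : V) : R := complex.Re `|v|.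

Definition norm_from_dot {K : numFieldType} {theta : K -> K}
    {V : normedModType K} (dot : {dot V for theta}) : Prop :=
  forall v, `|v| ^+ 2 = dot v v.

Definition real_hilbert (V : completeNormedModType R) : Prop :=
  exists dot : {dot V for idfun}, norm_from_dot dot.

Definition complex_hilbert (V : completeNormedModType R[i]) : Prop :=
  exists dot : {dot V for Num.conj}, norm_from_dot dot.

Definition orthonormal_basis (V : completeNormedModType R[i])
    (dot : {dot V for Num.conj}) (E : set V) : Prop :=
  [/\ forall e, E e -> dot e e = 1,
      forall e e', E e -> E e' -> e != e' -> dot e e' = 0 &
      forall v (eps : R), 0 < eps -> exists (s : seq V) (c : V -> R[i]),
        {in s, forall e, E e} /\ normR (v - \sum_(e <- s) c e *: e) < eps].

End hilbert.

(* The space W^* of a Gelfand triple consists of the bounded antilinear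
   functionals, so that L^2 -> W^*, g |-> (w |-> \int g w^* ), is linear.
   The pairing <w, l>_{W,W^*}, linear in w, is then the conjugate of l w. *)
Section antidual.
Context {R : realType}.
Variable W : normedModType R[i].

Definition is_antidual (l : W -> R[i]^o) : Prop :=
  (forall a v w, l (a *: v + w) = a^* * l v + l w) /\
  (exists c : R, forall w, Normc.normc (l w) <= c * normR w).

Definition antidual_pred : {pred W -> R[i]^o} := fun l => `[< is_antidual l >].

Record antidual := Antidual {
  antidual_fun :> W -> R[i]^o ;
  _ : antidual_fun \in antidual_pred }.

HB.instance Definition _ := [isSub for antidual_fun].
HB.instance Definition _ := [Choice of antidual by <:].

Let antidual_submod_closed : submod_closed antidual_pred.
Proof.
split=> [|a f g].
  have E v : (0 : W -> R[i]^o) v = 0 by [].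
  rewrite unfold_in; apply/asboolP; split=> [b v w|].
    by rewrite !E mulr0 addr0.
  by exists 0 => w; rewrite mul0r E Normc.normc0.
rewrite !unfold_in => /asboolP[lf [c cf]] /asboolP[lg [c' cg]].
have E v : (a *: f + g) v = a * f v + g v by [].
apply/asboolP; split=> [b v w|]; first by rewrite !E lf lg; ring.
exists (Normc.normc a * c + c') => w; rewrite E mulrDl -mulrA.
apply: (le_trans (le_normcD _ _)); rewrite lerD//.
rewrite Normc.normcM ler_wpM2l//; case: (a) => x y; exact: sqrtr_ge0.
Qed.

HB.instance Definition _ := GRing.isSubmodClosed.Build _ _ antidual_pred
  antidual_submod_closed.
HB.instance Definition _ := [SubChoice_isSubLmodule of antidual by <:].

Definition dual_norm (l : antidual) : R :=
  sup [set Normc.normc (l w) | w in [set w | normR w <= 1]].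

Definition pairing (w : W) (l : antidual) : R[i] := (l w)^*.

(* Hilbert-Schmidt norm computed in an orthonormal basis E of W. *)
Definition hs_norm (E : set W) (A : W -> antidual) : R :=
  Num.sqrt (fine (\esum_(e in E) (dual_norm (A e) ^+ 2)%:E)).

End antidual.

Section gelfand.
Context {R : realType} {n : nat}.
Variable Omega : set 'rV[R]_n.+1.

Local Notation mu := (lebesgue_rV R n.+1).

(* V is a dense, continuously embedded subspace of L^2(Omega); the embedding of
   L^2(Omega) into V^* is then the map described by [represents]. *)
Record gelfand_triple {V : normedModType R[i]}
    (iota : V -> 'rV[R]_n.+1 -> R[i]) : Prop := {
  gelfand_L2 : forall v, in_L2 mu Omega (iota v) ;
  gelfand_linear : forall a u v,
    {ae mu, forall x, Omega x -> iota (a *: u + v) x = a * iota u x + iota v x} ;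
  gelfand_injective : forall v,
    {ae mu, forall x, Omega x -> iota v x = 0} -> v = 0 ;
  gelfand_continuous : exists c : R, forall v,
    (L2norm mu Omega (iota v) <= (c * normR v)%:E)%E ;
  gelfand_dense : forall g, in_L2 mu Omega g -> forall eps : R, 0 < eps ->
    exists v, (L2norm mu Omega (fun x => g x - iota v x)%R < eps%:E)%E }.

(* l is the image in W^* of the element g of L^2(Omega). *)
Definition represents {W : normedModType R[i]} (iW : W -> 'rV[R]_n.+1 -> R[i])
    (l : antidual W) (g : 'rV[R]_n.+1 -> R[i]) : Prop :=
  in_L2 mu Omega g /\ forall w, l w = L2inner mu Omega g (iW w).

End gelfand.

Section model.
Context {R : realType} {X : completeNormedModType R}
        {U W : completeNormedModType R[i]}.
Variables (K : U -> antidual W) (B : U -> X -> antidual W).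

Record affine_bilinear : Prop := {
  K_linear : linear K ;
  K_bounded : exists c : R, forall u, dual_norm (K u) <= c * normR u ;
  B_linear : forall h, linear (B ^~ h) ;
  B_real_linear : forall u (r : R) h k,
    B u (r *: h + k) = r%:C%C *: B u h + B u k ;
  B_bounded : exists c : R, forall u h,
    dual_norm (B u h) <= c * normR u * `|h| }.

Definition Dop (theta : X) (u : U) : antidual W := K u + B u theta.

(* The inverse of Dop theta; meaningful when the latter is bijective. *)
Definition Dinv (theta : X) (l : antidual W) : U :=
  xget 0 [set u | Dop theta u = l].

Definition boundedly_invertible (theta : X) : Prop :=
  bijective (Dop theta) /\
  exists c : R, forall l, normR (Dinv theta l) <= c * dual_norm l.

Definition bounded_to_bounded (pi : R -> R) : Prop :=
  (forall r, 0 <= r -> 0 <= pi r) /\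
  (forall A : set R, A `<=` [set r | 0 <= r] ->
     bounded_set A -> bounded_set (pi @` A)).

Definition bounded_inverse_assumption (Dom : set X) : Prop :=
  exists pi : R -> R, bounded_to_bounded pi /\
    forall theta, Dom theta ->
      forall l, normR (Dinv theta l) <= pi `|theta| * dual_norm l.

Section lifted.
Context {n : nat} {Xh : completeNormedModType R}
        {Uh : completeNormedModType R[i]}.
Variables (Omega : set 'rV[R]_n.+1) (iU : U -> 'rV[R]_n.+1 -> R[i])
          (iW : W -> 'rV[R]_n.+1 -> R[i]) (Dom : set X)
          (jX : Xh -> X) (jU : Uh -> U).

Local Notation L2norm := (L2norm (lebesgue_rV R n.+1) Omega).
Local Notation represents := (represents Omega iW).

(* jU and jX are the inclusions of Uh into U and of Xh into X. *)
Record lifted_regularity : Prop := {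
  lifted_Uh_hilbert : complex_hilbert Uh ;
  lifted_Xh_hilbert : real_hilbert Xh ;
  lifted_jU_linear : linear jU ;
  lifted_jU_injective : injective jU ;
  lifted_Uh_gelfand : gelfand_triple Omega (iU \o jU) ;
  lifted_jX_linear : linear jX ;
  lifted_jX_injective : injective jX ;
  lifted_jX_le : forall t, `|jX t| <= `|t| ;
  lifted_jX_dense : dense (range jX) ;
  lifted_D : forall t, exists c : R, forall u, exists g,
    represents (Dop (jX t) (jU u)) g /\ (L2norm g <= (c * normR u)%:E)%E ;
  lifted_B : exists c : R, forall u t, exists g,
    represents (B (jU u) (jX t)) g /\
    (L2norm g <= (c * normR u * `|t|)%:E)%E ;
  lifted_Dinv : forall t, Dom (jX t) ->
    exists c : R, forall l g, represents l g -> exists u,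
      jU u = Dinv (jX t) l /\ ((normR u)%:E <= c%:E * L2norm g)%E ;
  lifted_bound : exists pih : R -> R, bounded_to_bounded pih /\
    forall t, Dom (jX t) -> forall l g u, represents l g ->
      jU u = Dinv (jX t) l -> ((normR u)%:E <= (pih `|t|)%:E * L2norm g)%E }.

End lifted.

Section covariance.
Context {n J : nat}.
Variable iU : U -> 'rV[R]_n.+1 -> R[i].

Definition Cov (u v : 'I_J -> U) (p : 'rV[R]_n.+1 * 'rV[R]_n.+1) : R[i] :=
  J%:R^-1 * \sum_(j < J) iU (u j) p.1 * (iU (v j) p.2)^*.

Variable f : 'I_J -> antidual W.

Definition Sol (theta : X) (j : 'I_J) : U := Dinv theta (f j).

Definition Fmap (theta : X) : 'rV[R]_n.+1 * 'rV[R]_n.+1 -> R[i] :=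
  Cov (Sol theta) (Sol theta).

Definition Fderiv (theta h : X) : 'rV[R]_n.+1 * 'rV[R]_n.+1 -> R[i] :=
  let phi j := Dinv theta (- B (Sol theta j) h) in
  fun p => Cov (Sol theta) phi p + Cov phi (Sol theta) p.

Definition Pi_f (w : W) : antidual W :=
  J%:R^-1 *: \sum_(j < J) pairing w (f j) *: f j.

End covariance.

End model.

(* Main.v *)
Require Import Defs.
From HB Require Import structures.
From mathcomp Require Import all_boot all_order all_algebra.
From mathcomp Require Import complex.
From mathcomp Require Import ring lra.
From mathcomp Require finmap.
From mathcomp Require Import all_classical all_reals all_analysis.
From mathcomp Require Import measurable_realfun.

(* Let u = S(theta), v = S(theta0), h = theta - theta0, delta = u - v and
   T = D(theta)^-1 B(.)h, so that delta = - T v and delta - phi = T delta.  Then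
     F(theta) - F(theta0) - F'(theta) h
       = Cov(u, T delta) + Cov(T delta, u) - Cov(delta, delta),
   and each term is Cov(A f, A' f) for bounded linear A, A' : W^* -> U with
   |A| |A'| of order |h|_X^2.  Hence the error is O(|h|_X^2), which is at most
   O(|h|_X |h|_Xh); the term with M is not even needed (M = 1 below).
   The bound independent of J is
     |Cov(A f, A' f)|_{L^2(Omega x Omega)} <= c^2 |A| |A'| |Pi_f|_HS :
   by Tonelli, for fixed y the L^2 norm in x of A (sum_j conj((A' f_j)(y)) f_j)
   is bounded by the dual norm of sum_j conj((A' f_j)(y)) f_j, which is the
   l^2 norm of its coefficients in the orthonormal basis E; integrating the
   coefficient at e in E over y gives |A' (Pi_f e)|^2. *)

Set Implicit Arguments.
Unset Strict Implicit.
Unset Printing Implicit Defensive.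

Import Order.TTheory GRing.Theory Num.Theory.
Import numFieldNormedType.Exports.

Local Open Scope classical_set_scope.
Local Open Scope ring_scope.

(** * Moduli and inner products *)

Section complex_modulus.
Variable R : realType.
Implicit Types z : R[i].
Local Notation normc := (@Normc.normc R).

Lemma normcC z : (normc z)%:C%C = `|z|.
Proof. by rewrite normc_def; case: z. Qed.

Lemma normc_ge0 z : 0 <= normc z.
Proof. by case: z => a b; exact: sqrtr_ge0. Qed.

Lemma normc_sqr z : normc z ^+ 2 = complex.Re z ^+ 2 + complex.Im z ^+ 2.
Proof. by case: z => a b /=; rewrite sqr_sqrtr// addr_ge0// sqr_ge0. Qed.

Lemma normc_real (r : R) : normc r%:C%C = `|r|.
Proof. by rewrite /= expr0n addr0 sqrtr_sqr. Qed.

Lemma normc_conj z : normc z^* = normc z.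
Proof. by apply: complexI; rewrite !normcC norm_conjC. Qed.

Lemma normc_sum (I : Type) (r : seq I) (F : I -> R[i]) :
  normc (\sum_(i <- r) F i) <= \sum_(i <- r) normc (F i).
Proof.
elim: r => [|i r IH]; first by rewrite !big_nil Normc.normc0.
by rewrite !big_cons; apply: (le_trans (le_normcD _ _)); rewrite lerD2l.
Qed.

Lemma normc_mulJ z : z * z^* = ((normc z) ^+ 2)%:C%C.
Proof. by rewrite -normCK -normcC rmorphXn. Qed.

Variable V : normedModType R[i].
Implicit Types v w : V.

(** The norm of a complex normed module takes values in [R[i]]; being nonnegative there, it has zero
    imaginary part, so [normR] loses nothing. *)
Lemma normRC v : (normR v)%:C%C = `|v|.
Proof.
have := normr_ge0 v; rewrite lecE /normR; case: `|v| => a b /= /andP[/eqP + _].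
by move=> ->.
Qed.

Lemma normR_ge0 v : 0 <= normR v.
Proof. by rewrite -lecR normRC; exact: normr_ge0. Qed.

Lemma normRZ a v : normR (a *: v) = normc a * normR v.
Proof. by apply: complexI; rewrite rmorphM/= !normRC normrZ normcC. Qed.

Lemma normRD v w : normR (v + w) <= normR v + normR w.
Proof. by rewrite -lecR rmorphD/= !normRC ler_normD. Qed.

Lemma normRN v : normR (- v) = normR v.
Proof. by rewrite /normR normrN. Qed.

Lemma normR0 : normR (0 : V) = 0.
Proof. by rewrite /normR normr0. Qed.

End complex_modulus.

Section dot_product.
Variables (R : realType) (W : completeNormedModType R[i]).
Variable dot : {dot W for Num.conj}.
Hypothesis dotE : norm_from_dot dot.
Local Notation normc := (@Normc.normc R).

Lemma dot_normR v : dot v v = ((normR v) ^+ 2)%:C%C.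
Proof. by rewrite -dotE -normRC rmorphXn. Qed.

Lemma dotC v w : dot w v = (dot v w)^*.
Proof. by rewrite hermC expr0 mul1r. Qed.

Lemma dot_CauchySchwarz v w : normc (dot v w) <= normR v * normR w.
Proof.
have [->|w0] := eqVneq w 0; first by rewrite linear0r normR0 Normc.normc0 mulr0.
have w2 : 0 < normR w.
  rewrite lt_neqAle normR_ge0 andbT eq_sym; apply: contra w0 => /eqP w0.
  by rewrite -normr_eq0 -normRC w0.
set b := (normR w ^+ 2)%:C%C; set a := dot v w.
have b2 : 0 < normR w ^+ 2 by rewrite exprn_gt0.
have bJ : b^* = b by rewrite conj_Creal// ger0_real// lecR ltW.
(* Up to the factor [b], this vector is the component of [v] orthogonal to [w]; scaling by [b]
   avoids a division. *)
have : dot (b *: v - a *: w) (b *: v - a *: w) =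
   ((normR w) ^+ 2 * ((normR w) ^+ 2 * normR v ^+ 2 - normc a ^+ 2))%:C%C.
  transitivity (b * (b * (normR v ^+ 2)%:C%C - a * a^*)); last first.
    by rewrite normc_mulJ /b -!(rmorphM, rmorphB).
  rewrite linearBl/= !linearBr/= !linearZl_LR !linearZr_LR/= bJ.
  rewrite (dotC v w) !dot_normR -/a -/b /GRing.scale/=.
  by ring.
rewrite dot_normR => /complexI H.
have : 0 <= normR w ^+ 2 * (normR w ^+ 2 * normR v ^+ 2 - normc a ^+ 2).
  by rewrite -H sqr_ge0.
rewrite pmulr_rge0// subr_ge0 mulrC -exprMn ler_sqr//.
  by rewrite nnegrE normc_ge0.
by rewrite nnegrE mulr_ge0// normR_ge0.
Qed.

End dot_product.

(** * Norms on the antidual space *)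

Section antidual_theory.
Variables (R : realType) (W : normedModType R[i]).
Implicit Types (l : antidual W) (v w : W).
Local Notation normc := (@Normc.normc R).

Lemma antidual_sum (I : Type) (r : seq I) (F : I -> antidual W) w :
  (\sum_(i <- r) F i) w = \sum_(i <- r) F i w.
Proof. by elim: r => [|i r IH]; rewrite ?big_nil// !big_cons -IH. Qed.

Lemma antidual_antilinear l a v w : l (a *: v + w) = a^* * l v + l w.
Proof. by case: l => l /= /[dup] /asboolP[]. Qed.

Lemma antidual0 l : l 0 = 0.
Proof.
have := antidual_antilinear l 1 0 0; rewrite scale1r addr0 rmorph1 mul1r.
by move=> /(congr1 (fun x => x - l 0)); rewrite subrr addrK.
Qed.

Lemma antidual_antilinear_sum (I : Type) (r : seq I) (c : I -> R[i]) (F : I -> W) l :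
  l (\sum_(i <- r) c i *: F i) = \sum_(i <- r) (c i)^* * l (F i).
Proof.
elim: r => [|i r IH]; first by rewrite !big_nil antidual0.
by rewrite !big_cons antidual_antilinear IH.
Qed.

(** A real [sup] is meaningful only for nonempty bounded sets; every later use of [dual_norm] as a
    supremum rests on this. *)
Lemma dual_norm_has_sup l :
  has_sup [set normc (l w) | w in [set w | normR w <= 1]].
Proof.
split; first by exists (normc (l 0)); exists 0 => //=; rewrite normR0.
have [c cl] : exists c : R, forall w, normc (l w) <= c * normR w.
  by case: l => l /= /[dup] /asboolP[].
exists `|c| => _ [w /= w1 <-]; apply: (le_trans (cl w)).
apply: (le_trans (ler_wpM2r (normR_ge0 w) (ler_norm c))).
by rewrite -[leRHS]mulr1 ler_wpM2l.
Qed.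

Lemma dual_norm_ge0 l : 0 <= dual_norm l.
Proof.
have [_ ub] := dual_norm_has_sup l.
by apply: (le_trans (normc_ge0 (l 0))); apply: ub_le_sup => //;
  exists 0 => //=; rewrite normR0.
Qed.

Lemma normc_le_dual_norm l w : normc (l w) <= dual_norm l * normR w.
Proof.
have [w0|w0] := eqVneq (normR w) 0.
  have -> : w = 0 by apply/normr0_eq0; rewrite -normRC w0.
  by rewrite antidual0 normR0 mulr0 Normc.normc0.
have wp : 0 < normR w by rewrite lt_neqAle eq_sym w0 normR_ge0.
have [_ ub] := dual_norm_has_sup l.
have : normc (l (((normR w)^-1)%:C%C *: w)) <= dual_norm l.
  apply: ub_le_sup => //; exists (((normR w)^-1)%:C%C *: w) => //=.
  by rewrite normRZ normc_real gtr0_norm ?invr_gt0// mulVf.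
rewrite -[X in l X]addr0 antidual_antilinear antidual0 addr0 Normc.normcM.
rewrite normc_conj normc_real gtr0_norm ?invr_gt0//.
by rewrite mulrC ler_pdivrMr.
Qed.

Lemma dual_norm_le l M : (forall w, normR w <= 1 -> normc (l w) <= M) ->
  dual_norm l <= M.
Proof.
move=> lM; apply: ge_sup; first by have [] := dual_norm_has_sup l.
by move=> _ [w /= w1 <-]; exact: lM.
Qed.

End antidual_theory.

(** * Coefficients of antilinear functionals in an orthonormal basis: Bessel and Parseval *)

Section orthonormal_basis_theory.
Variables (R : realType) (W : completeNormedModType R[i]).
Variables (dot : {dot W for Num.conj}) (E : set W).
Hypothesis dotE : norm_from_dot dot.
Hypothesis basisE : orthonormal_basis dot E.
Local Notation normc := (@Normc.normc R).

(* The square of the dual norm is the supremum of [coef_sqsum s] over finite s. *)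
Definition coef_sqsum (s : seq W) (l : antidual W) : R :=
  \sum_(e <- s) normc (l e) ^+ 2.

(** The sum is a partial Riesz representer of [l]; since [l] is antilinear, its coefficients [l e']
    are not conjugated. *)
Lemma dot_riesz_sum (l : antidual W) s e : uniq s -> {in s, forall e, E e} -> e \in s ->
  dot (\sum_(e' <- s) l e' *: e') e = l e.
Proof.
move=> us sE es; have [E1 E0 _] := basisE.
rewrite linear_sumlz (bigD1_seq e)//= linearZl_LR/= (E1 _ (sE _ es)).
rewrite big1_seq ?addr0 ?mulr1// => e' /andP[e'e e's].
by rewrite linearZl_LR/= (E0 _ _ (sE _ e's) (sE _ es) e'e) mulr0.
Qed.

Lemma normR_riesz_sum s (l : antidual W) : uniq s -> {in s, forall e, E e} ->
  normR (\sum_(e <- s) l e *: e) ^+ 2 = coef_sqsum s l.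
Proof.
move=> us sE; apply: complexI; rewrite -(dot_normR dotE).
rewrite [X in dot _ X = _]big_seq linear_sumr/= rmorph_sum/= [RHS]big_seq.
apply: eq_bigr => e es.
by rewrite linearZr_LR/= dot_riesz_sum// -normc_mulJ mulrC.
Qed.

(** Testing [l] on its own partial Riesz representer [w] gives
    [normR w ^+ 2 <= dual_norm l * normR w]. *)
Lemma bessel s (l : antidual W) : uniq s -> {in s, forall e, E e} ->
  coef_sqsum s l <= dual_norm l ^+ 2.
Proof.
move=> us sE; set w := \sum_(e <- s) l e *: e.
have : normc (l w) <= dual_norm l * normR w by exact: normc_le_dual_norm.
have -> : l w = ((normR w) ^+ 2)%:C%C.
  rewrite normR_riesz_sum// rmorph_sum/= antidual_antilinear_sum.
  by apply: eq_bigr => e _; rewrite -normc_mulJ mulrC.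
rewrite -(normR_riesz_sum _ us sE) -/w.
rewrite normc_real ger0_norm ?sqr_ge0// expr2.
have [->|w0] := eqVneq (normR w) 0; first by rewrite mul0r sqr_ge0.
have wp : 0 < normR w by rewrite lt_neqAle eq_sym w0 normR_ge0.
by rewrite ler_pM2r// => wl; rewrite -expr2 ler_sqr// nnegrE ?dual_norm_ge0 ?ltW.
Qed.

(** On a finite combination [v] of basis vectors, [l] is the product with a partial Riesz
    representer of norm at most [Num.sqrt M]; density of such [v] and continuity of [l] give the
    rest. *)
Lemma dual_norm_sqr_le (l : antidual W) (M : R) :
  (forall s, uniq s -> {in s, forall e, E e} -> coef_sqsum s l <= M) ->
  dual_norm l ^+ 2 <= M.
Proof.
move=> lM; have M0 : 0 <= M by have := lM [::]; rewrite /coef_sqsum big_nil; exact.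
have [E1 E0 Edense] := basisE.
suff lw w : normc (l w) <= Num.sqrt M * normR w.
  rewrite -[leRHS]sqr_sqrtr// ler_sqr ?nnegrE ?dual_norm_ge0 ?sqrtr_ge0//.
  apply: dual_norm_le => w w1; apply: (le_trans (lw w)).
  by rewrite -[leRHS]mulr1 ler_wpM2l// sqrtr_ge0.
apply/ler_addgt0Pr => eps eps0.
(* Factor multiplying the approximation error: [l (w - v)] costs [dual_norm l], replacing [normR v]
   by [normR w] costs [Num.sqrt M], and [+ 1] keeps it nonzero. *)
have C0 : 0 < dual_norm l + Num.sqrt M + 1.
  by rewrite ltr_wpDl// addr_ge0 ?dual_norm_ge0 ?sqrtr_ge0.
have [s [c [sE]]] := Edense w _ (divr_gt0 eps0 C0).
set v := \sum_(e <- s) _ => wv.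
have lv : normc (l v) <= Num.sqrt M * normR v.
  (* The list given by density may repeat vectors, which would spoil the representer; [v] itself
     keeps the repetitions. *)
  set u := \sum_(e <- undup s) l e *: e.
  have -> : l v = dot u v.
    rewrite antidual_antilinear_sum /v [LHS]big_seq [X in dot _ X]big_seq linear_sumr/=.
    apply: eq_bigr => e es; rewrite linearZr_LR/=; congr (_ * _).
    rewrite /u dot_riesz_sum ?undup_uniq ?mem_undup// => e'.
    by rewrite mem_undup; exact: sE.
  apply: (le_trans (dot_CauchySchwarz dotE u v)).
  rewrite ler_wpM2r ?normR_ge0// -[leLHS]ger0_norm ?normR_ge0// -sqrtr_sqr.
  have sE' : {in undup s, forall e, E e} by move=> e; rewrite mem_undup; exact: sE.
  by rewrite ler_wsqrtr// normR_riesz_sum ?undup_uniq// lM ?undup_uniq.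
have -> : l w = l (w - v) + l v.
  by rewrite -{1}[w](subrK v) -[w - v]scale1r antidual_antilinear rmorph1 mul1r scale1r.
apply: (le_trans (le_normcD _ _)).
have nv : normR v <= normR w + normR (w - v).
  by rewrite -[normR (w - v)]normRN (le_trans _ (normRD _ _))// opprB addrC subrK.
have := normc_le_dual_norm l (w - v).
have wvC : normR (w - v) * (dual_norm l + Num.sqrt M + 1) <= eps.
  by rewrite -ler_pdivlMr// ltW.
have := sqrtr_ge0 M; have := dual_norm_ge0 l; have := normR_ge0 (w - v).
move: lv nv wvC; move: (normc (l v)) (normc _) (Num.sqrt M) (dual_norm l)
  (normR (w - v)) (normR v) (normR w).
move=> a b m d x y z; nra.
Qed.

End orthonormal_basis_theory.

(** * Hilbert-Schmidt norm of the source covariance *)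

(** Induction on [r]; the new cross term is absorbed by the square of [|a i| y - |b i| x], with [x],
    [y] the square roots of the remaining sums. *)
Lemma CauchySchwarz_sum (R : rcfType) (I : Type) (r : seq I) (a b : I -> R) :
  (\sum_(i <- r) a i * b i) ^+ 2 <=
  (\sum_(i <- r) a i ^+ 2) * (\sum_(i <- r) b i ^+ 2).
Proof.
elim: r => [|i r IH]; first by rewrite !big_nil expr0n mulr0.
rewrite !big_cons; set A := \sum_(j <- r) a j ^+ 2 in IH *.
set B := \sum_(j <- r) b j ^+ 2 in IH *.
have A0 : 0 <= A by apply: sumr_ge0 => j _; exact: sqr_ge0.
have B0 : 0 <= B by apply: sumr_ge0 => j _; exact: sqr_ge0.
move: IH; set S := \sum_(j <- r) _.
rewrite -(sqr_sqrtr A0) -(sqr_sqrtr B0) -exprMn.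
have := sqrtr_ge0 A; have := sqrtr_ge0 B.
move: (Num.sqrt A) (Num.sqrt B) => x y y0 x0 Sxy.
have {}Sxy : `|S| <= x * y by rewrite -ler_sqr ?nnegrE ?mulr_ge0// real_normK ?num_real.
have : `|a i * b i * S| <= `|a i| * `|b i| * (x * y).
  by rewrite !normrM ler_wpM2l.
have := ler_norm (a i * b i * S).
have : S ^+ 2 <= (x * y) ^+ 2.
  by rewrite -[S ^+ 2]real_normK ?num_real// ler_sqr ?nnegrE ?mulr_ge0.
have := sqr_ge0 (`|a i| * y - `|b i| * x).
rewrite sqrrB !exprMn !real_normK ?num_real//.
move: (`|a i|) (`|b i|) => p q; nra.
Qed.

Section hilbert_schmidt.
Import finmap.
Variables (R : realType) (W : completeNormedModType R[i]).
Variables (dot : {dot W for Num.conj}) (E : set W).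
Hypothesis dotE : norm_from_dot dot.
Hypothesis basisE : orthonormal_basis dot E.
Local Notation normc := (@Normc.normc R).

Variables (J : nat) (f : 'I_J -> antidual W).

Lemma normc_comb_sqr (c z : 'I_J -> R[i]) :
  normc (\sum_j c j * z j) ^+ 2 <=
  (\sum_j normc (c j) ^+ 2) * (\sum_j normc (z j) ^+ 2).
Proof.
apply: le_trans (CauchySchwarz_sum _ _ _); rewrite ler_sqr ?nnegrE ?normc_ge0//.
  apply: (le_trans (normc_sum _ _)).
  by rewrite le_eqVlt; apply/orP; left; apply/eqP;
    apply: eq_bigr => j _; exact: Normc.normcM.
by apply: sumr_ge0 => j _; rewrite mulr_ge0// normc_ge0.
Qed.

(** Crude bound whose second factor depends on all the sources; it serves only to show that the
    Hilbert-Schmidt sum of [Pi_f f] is finite. *)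
Lemma dual_norm_comb_sqr (c : 'I_J -> R[i]) :
  dual_norm (\sum_j c j *: f j) ^+ 2 <=
  (\sum_j normc (c j) ^+ 2) * (\sum_j dual_norm (f j) ^+ 2).
Proof.
set M := _ * _.
have M0 : 0 <= M by rewrite mulr_ge0 ?sumr_ge0// => j _; exact: sqr_ge0.
rewrite -[leRHS]sqr_sqrtr// ler_sqr ?nnegrE ?dual_norm_ge0 ?sqrtr_ge0//.
apply: dual_norm_le => w w1; rewrite -[leLHS]ger0_norm ?normc_ge0// -sqrtr_sqr.
rewrite ler_wsqrtr// antidual_sum; apply: (le_trans (normc_comb_sqr _ _)).
rewrite ler_wpM2l ?sumr_ge0// => [j _|]; first exact: sqr_ge0.
apply: ler_sum => j _; rewrite ler_sqr ?nnegrE ?normc_ge0 ?dual_norm_ge0//.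
apply: (le_trans (normc_le_dual_norm _ _)).
by rewrite -[leRHS]mulr1 ler_wpM2l ?dual_norm_ge0.
Qed.

(* A finite part of the basis suffices up to eta, so neither countability of E
   nor measurability of y |-> dual_norm (sum_j c_j(y) f_j) is ever needed. *)
Lemma dual_norm_comb_tail (eta : R) : 0 < eta ->
  exists s : seq W, [/\ uniq s, {in s, forall e, E e} & forall c : 'I_J -> R[i],
    dual_norm (\sum_j c j *: f j) ^+ 2 <=
    coef_sqsum s (\sum_j c j *: f j) + eta * \sum_j normc (c j) ^+ 2].
Proof.
move=> eta0; pose Q s := \sum_j coef_sqsum s (f j).
pose P s := uniq s /\ {in s, forall e, E e}.
have supQ : has_sup [set Q s | s in P].
  split; first by exists (Q [::]), [::].
  exists (\sum_j dual_norm (f j) ^+ 2) => _ [s [us sE] <-].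
  by apply: ler_sum => j _; exact: (bessel dotE basisE).
(* As [Q s] is within [eta] of the supremum, any finite part [t'] of the basis disjoint from [s] has
   [Q t' <= eta], uniformly in the coefficients [c]. *)
have [_ [s [us sE] <-] Qs] := sup_adherent eta0 supQ.
exists s; split => // c; set l := \sum_j _; set C := \sum_j normc _ ^+ 2.
have C0 : 0 <= C by apply: sumr_ge0 => j _; exact: sqr_ge0.
apply: (dual_norm_sqr_le dotE basisE) => t ut tE.
pose t' := [seq e <- t | e \notin s].
have ts : coef_sqsum t l <= coef_sqsum s l + coef_sqsum t' l.
  rewrite /coef_sqsum (bigID (mem s))/= big_filter lerD2r.
  rewrite -big_filter [leRHS](bigID (mem t))/= -[X in _ <= X + _]big_filter.
  rewrite (perm_big [seq e <- s | e \in t]); first by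
    rewrite lerDl sumr_ge0// => e _; exact: sqr_ge0.
  apply: uniq_perm; rewrite ?filter_uniq// => e.
  by rewrite !mem_filter andbC.
apply: (le_trans ts); rewrite lerD2l.
have ct' : coef_sqsum t' l <= C * Q t'.
  rewrite /Q /coef_sqsum exchange_big/= mulr_sumr; apply: ler_sum => e _.
  by rewrite /l antidual_sum; exact: normc_comb_sqr.
apply: (le_trans ct'); rewrite mulrC ler_wpM2r//.
have : Q (s ++ t') <= sup [set Q s | s in P].
  apply: ub_le_sup; first by case: supQ.
  exists (s ++ t') => //; split.
    rewrite cat_uniq us filter_uniq// andbT -all_predC; apply/allP => e /=.
    by rewrite mem_filter => /andP[].
  by move=> e; rewrite mem_cat mem_filter => /orP[/sE|/andP[_ /tE]].
have -> : Q (s ++ t') = Q s + Q t'.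
  by rewrite /Q -big_split/=; apply: eq_bigr => j _; rewrite /coef_sqsum big_cat.
move: Qs; move: (sup _) (Q s) (Q t') => x y z; lra.
Qed.

Lemma Pi_f_comb e :
  Pi_f f e = \sum_j (J%:R^-1 * pairing e (f j)) *: f j.
Proof. by rewrite /Pi_f scaler_sumr; apply: eq_bigr => j _; rewrite scalerA. Qed.

Lemma sum_dual_norm_Pi_f_le_hs_norm s : uniq s -> {in s, forall e, E e} ->
  \sum_(e <- s) dual_norm (Pi_f f e) ^+ 2 <= hs_norm E (Pi_f f) ^+ 2.
Proof.
move=> us sE.
set S := \esum_(e in E) (dual_norm (Pi_f f e) ^+ 2)%:E.
have S0 : (0 <= S)%E by apply: esum_ge0 => e _; rewrite lee_fin sqr_ge0.
have sS : ((\sum_(e <- s) dual_norm (Pi_f f e) ^+ 2)%:E <= S)%E.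
  apply: esum_ge; exists [set` s].
    by split; [exact: finite_seq|move=> e /= /sE].
  by rewrite -sumEFin fsbig_seq.
(* [fine +oo = 0], so the sum defining [hs_norm] must be shown finite. *)
have [N SN] : exists N : R, (S <= N%:E)%E.
  pose D := \sum_j dual_norm (f j) ^+ 2.
  exists ((\sum_j normc (J%:R^-1 : R[i]) ^+ 2 * dual_norm (f j) ^+ 2) * D).
  apply: ge_ereal_sup => _ [A [finA AE] <-].
  rewrite fsbig_finite//= sumEFin lee_fin.
  have AE' : {in fset_set A, forall e, E e}.
    by move=> e; rewrite in_fset_set// => /set_mem/AE.
  have uA : uniq (fset_set A) by exact: fset_uniq.
  apply: (@le_trans _ _ (\sum_(e <- fset_set A)
    (\sum_j normc (J%:R^-1 * pairing e (f j)) ^+ 2) * D)).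
    by apply: ler_sum => e _; rewrite Pi_f_comb; exact: dual_norm_comb_sqr.
  rewrite -mulr_suml ler_wpM2r ?sumr_ge0// => [j _|]; first exact: sqr_ge0.
  rewrite exchange_big/=; apply: ler_sum => j _.
  under eq_bigr do rewrite Normc.normcM exprMn /pairing normc_conj.
  rewrite -mulr_sumr ler_wpM2l ?sqr_ge0//.
  exact: (bessel dotE basisE).
rewrite /hs_norm -/S sqr_sqrtr ?fine_ge0// -lee_fin fineK//.
by rewrite ge0_fin_numE// (le_lt_trans SN) ?ltry.
Qed.

End hilbert_schmidt.

(** * Measurability and squared L2 norms *)

(** The sigma-algebra is generated by the coordinates, so its link to the topology has to be proved:
    an open set is the union of the countably many rational boxes that it contains. *)
Lemma open_measurable_rV (R : realType) (n : nat) (A : set 'rV[R]_n) :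
  open A -> measurable A.
Proof.
move=> oA.
(* Boxes with rational centre and radius 1/(k+1). *)
pose box (q : 'rV[rat]_n * nat) : set 'rV[R]_n :=
  [set y | forall j, `|ratr (q.1 ord0 j) - y ord0 j| < q.2.+1%:R^-1].
pose F q := if `[< box q `<=` A >] then box q else set0.
have mbox q : measurable (box q).
  have -> : box q = \bigcap_(j in [set: 'I_n])
      ((fun y : 'rV[R]_n => y ord0 j) @^-1` ball (ratr (q.1 ord0 j) : R) q.2.+1%:R^-1).
    by apply/seteqP; split => [y yq j _|y yq j]; [exact: yq|exact: (yq j)].
  apply: fin_bigcap_measurable => // j _.
  rewrite -[X in measurable X]setTI; apply: measurable_coord => //.
  exact: measurable_realfun.measurable_ball.
rewrite (_ : A = \bigcup_q F q).
  apply: countable_bigcupT_measurable => // q.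
  by rewrite /F; case: asboolP.
apply/seteqP; split => [x Ax|x [q _]]; last first.
  by rewrite /F; case: asboolP => // + xq; exact.
have /nbhs_ballP[e /= e0 xeA] : nbhs x A by exact: open_nbhs_nbhs.
(* Half of [e], because a point of the box is reached from [x] through the rational centre, at the
   cost of two radii. *)
have [k ke] : exists k : nat, k.+1%:R^-1 < e / 2.
  have [k _ /(_ k (leqnn k)) ke] :=
    near_infty_natSinv_lt (PosNum (divr_gt0 e0 (@ltr0Sn R 1))).
  by exists k.
have k0 : 0 < k.+1%:R^-1 :> R by rewrite invr_gt0.
have Q (j : 'I_n) : {q : rat | `|ratr q - x ord0 j| < k.+1%:R^-1}.
  have qx : x ord0 j - k.+1%:R^-1 < x ord0 j + k.+1%:R^-1.
    by rewrite ltrBlDr -addrA ltrDl addr_gt0.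
  apply: cid; have [q] := rat_in_itvoo qx.
  by rewrite in_itv/= => q1; exists q; rewrite ltr_distl.
exists (\row_j sval (Q j), k) => //.
rewrite /F; case: asboolP => [_|[]] j /=.
  by rewrite mxE; exact: svalP (Q j).
move=> jq; apply: xeA; split => // i j'; rewrite (ord1 i).
have := jq j'; rewrite /= mxE; have := svalP (Q j'); move: (sval (Q j')) => q qx qj.
rewrite /ball/= -(subrKA (ratr q)).
apply: (le_lt_trans (ler_normD _ _)); rewrite (splitr e) ltrD//.
  by rewrite distrC (lt_trans qx).
by rewrite (lt_trans qj).
Qed.

Section complex_measurable.
Context d (T : measurableType d) (R : realType).
Variable D : set T.
Implicit Types f g : T -> R[i].
Local Notation normc := (@Normc.normc R).

Definition measurable_complex f :=
  measurable_fun D (fun x => complex.Re (f x)) /\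
  measurable_fun D (fun x => complex.Im (f x)).

Lemma measurable_complex_cst z : measurable_complex (fun=> z).
Proof. by split; exact: measurable_cst. Qed.

Lemma measurable_complexD f g : measurable_complex f -> measurable_complex g ->
  measurable_complex (fun x => f x + g x).
Proof.
move=> [rf jf] [rg jg]; split.
  by under eq_fun do rewrite raddfD/=; exact: measurable_funD.
by under eq_fun do rewrite raddfD/=; exact: measurable_funD.
Qed.

Lemma measurable_complexM f g : measurable_complex f -> measurable_complex g ->
  measurable_complex (fun x => f x * g x).
Proof.
move=> [rf jf] [rg jg]; split.
  rewrite (_ : (fun x => _) = (fun x => complex.Re (f x) * complex.Re (g x) -
      complex.Im (f x) * complex.Im (g x))).
    by apply: measurable_funB; exact: measurable_funM.
  by apply/funext => x; case: (f x) (g x) => [a b] [].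
rewrite (_ : (fun x => _) = (fun x => complex.Re (f x) * complex.Im (g x) +
    complex.Im (f x) * complex.Re (g x))).
  by apply: measurable_funD; exact: measurable_funM.
by apply/funext => x; case: (f x) (g x) => [a b] [].
Qed.

Lemma measurable_complex_conj f : measurable_complex f ->
  measurable_complex (fun x => (f x)^*).
Proof.
move=> [rf jf]; split.
  rewrite (_ : (fun x => _) = (fun x => complex.Re (f x)))//.
  by apply/funext => x; case: (f x).
rewrite (_ : (fun x => _) = (fun x => - complex.Im (f x))).
  exact: measurable_funN.
by apply/funext => x; case: (f x).
Qed.

Lemma measurable_complex_sum (I : Type) (s : seq I) (f : I -> T -> R[i]) :
  (forall i, measurable_complex (f i)) ->
  measurable_complex (fun x => \sum_(i <- s) f i x).
Proof.
move=> mf; elim: s => [|i s IH].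
  by under eq_fun do rewrite big_nil; exact: measurable_complex_cst.
by under eq_fun do rewrite big_cons; exact: measurable_complexD.
Qed.

Lemma measurable_normc_sqr f : measurable_complex f ->
  measurable_fun D (fun x => (normc (f x) ^+ 2)%:E).
Proof.
move=> [rf jf]; apply/measurable_EFinP; under eq_fun do rewrite normc_sqr.
by apply: measurable_funD; exact: measurable_funX.
Qed.

Variable mu : {measure set T -> \bar R}.
Hypothesis mD : measurable D.

(** The squared L2 norm as a plain integral, to which additivity and Tonelli apply directly. *)
Definition sqint f : \bar R := \int[mu]_(x in D) (normc (f x) ^+ 2)%:E.

Lemma sqintE f : sqint f = (L2norm mu D f `^ 2)%E.
Proof.
rewrite /L2norm poweR_Lnorm//; rewrite /sqint integral_mkcond; apply: eq_integral => x _.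
rewrite !patchE; case: ifPn => _; last by rewrite abse0 poweR_EFin powR_mulrn// expr0n.
by rewrite abse_EFin poweR_EFin powR_mulrn// ger0_norm ?normc_ge0.
Qed.

Lemma L2norm_le f (c : R) : 0 <= c ->
  (L2norm mu D f <= c%:E)%E <-> (sqint f <= (c ^+ 2)%:E)%E.
Proof.
move=> c0; rewrite sqintE.
have /gee0P[->|[r r0 ->]] : (0 <= L2norm mu D f)%E by exact: Lnorm_ge0.
  by rewrite poweRyr ?pnatr_eq0// !leye_eq.
by rewrite poweR_EFin powR_mulrn// !lee_fin ler_sqr.
Qed.

Lemma sqint_ae_eq f g : measurable_complex f -> measurable_complex g ->
  {ae mu, forall x, D x -> f x = g x} -> sqint f = sqint g.
Proof.
move=> mf mg fg; apply: ge0_ae_eq_integral => //.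
- exact: measurable_normc_sqr.
- exact: measurable_normc_sqr.
- by move=> x _; rewrite lee_fin sqr_ge0.
- by move=> x _; rewrite lee_fin sqr_ge0.
by apply: filterS fg => x fg /fg ->.
Qed.

(** Pointwise, [(a + b + c) ^+ 2 <= 3 * (a ^+ 2 + b ^+ 2 + c ^+ 2)]; this stands in for the triangle
    inequality in L2. *)
Lemma sqint_add3 f g h : measurable_complex f -> measurable_complex g ->
  measurable_complex h ->
  (sqint (fun x => (f x + g x + h x)%R) <= 3%:E * (sqint f + sqint g + sqint h))%E.
Proof.
move=> mf mg mh.
have m2 k : measurable_complex k -> measurable_fun D (fun x => (normc (k x) ^+ 2)%:E).
  exact: measurable_normc_sqr.
have p2 (k : T -> R[i]) : forall x, D x -> (0 <= (normc (k x) ^+ 2)%:E)%E.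
  by move=> x _; rewrite lee_fin sqr_ge0.
rewrite /sqint -ge0_integralD; [| by [] | exact: p2 | exact: m2 | exact: p2 | exact: m2].
rewrite -ge0_integralD; [| by [] | | | exact: p2 | exact: m2]; last first.
- by apply: emeasurable_funD; exact: m2.
- by move=> x Dx; rewrite adde_ge0// p2.
rewrite -ge0_integralZl//; last first.
- by move=> x Dx; rewrite !adde_ge0// p2.
- by apply: emeasurable_funD; [apply: emeasurable_funD|]; exact: m2.
apply: ge0_le_integral => //.
- exact: p2.
- by apply: m2; do 2!apply: measurable_complexD => //.
- apply: measurable_funeM.
  by apply: emeasurable_funD; [apply: emeasurable_funD|]; exact: m2.
move=> x _; rewrite -!EFinD -EFinM lee_fin.
have fgh : normc (f x + g x + h x) <= normc (f x) + normc (g x) + normc (h x).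
  by rewrite (le_trans (le_normcD _ _))// lerD2r le_normcD.
have /le_trans -> // : normc (f x + g x + h x) ^+ 2 <=
    (normc (f x) + normc (g x) + normc (h x)) ^+ 2.
  by rewrite ler_sqr ?nnegrE ?addr_ge0 ?normc_ge0.
move: (normc _) (normc _) (normc _) => a b c.
have := sqr_ge0 (a - b); have := sqr_ge0 (b - c); have := sqr_ge0 (a - c); nra.
Qed.

End complex_measurable.

(** * Bound for sample covariances *)

Lemma linear_prop0 (K : pzRingType) (V V' : lmodType K) (A : V -> V') :
  linear A -> A 0 = 0.
Proof. by move=> lA; have := lA (-1) 0 0; rewrite scaler0 addr0 scaleN1r addNr. Qed.

Lemma linear_prop_sum (K : pzRingType) (V V' : lmodType K) (A : V -> V')
    (I : Type) (r : seq I) (c : I -> K) (F : I -> V) : linear A ->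
  A (\sum_(i <- r) c i *: F i) = \sum_(i <- r) c i *: A (F i).
Proof.
move=> lA; elim: r => [|i r IH]; first by rewrite !big_nil linear_prop0.
by rewrite !big_cons lA IH.
Qed.

Section covariance_bound.
Context d (T : measurableType d) (R : realType).
Variables (mu : {sigma_finite_measure set T -> \bar R}) (D : set T).
Hypothesis mD : measurable D.
Variables (V W : completeNormedModType R[i]) (iota : V -> T -> R[i]) (c : R).
Hypothesis miota : forall v, measurable_complex D (iota v).
Hypothesis iota_linear : forall a u v,
  {ae mu, forall x, D x -> iota (a *: u + v) x = a * iota u x + iota v x}.
Hypothesis iota_bounded : forall v, (sqint D mu (iota v) <= ((c * normR v) ^+ 2)%:E)%E.
Local Notation normc := (@Normc.normc R).

(** Linearity of [iota] holds off a null set that depends on the vectors; a finite sum involves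
    finitely many such sets. *)
Lemma iota_sum (I : Type) (r : seq I) (k : I -> R[i]) (F : I -> V) :
  {ae mu, forall x, D x ->
    iota (\sum_(i <- r) k i *: F i) x = \sum_(i <- r) k i * iota (F i) x}.
Proof.
elim: r => [|i r IH].
  (* Almost everywhere [iota 0 x = iota 0 x + iota 0 x], so [iota 0] vanishes there. *)
  have := iota_linear 1 0 0; apply: filterS => x + Dx => /(_ Dx).
  rewrite !big_nil scale1r addr0 mul1r => /(congr1 (fun z => z - iota 0 x)).
  by rewrite subrr addrK.
have := iota_linear (k i) (F i) (\sum_(j <- r) k j *: F j).
move: IH; apply: filterS2 => x + + Dx => /(_ Dx) IH /(_ Dx).
by rewrite !big_cons IH.
Qed.

Lemma sqint_sum (I : Type) (r : seq I) (k : I -> R[i]) (F : I -> V) :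
  sqint D mu (fun x => \sum_(i <- r) k i * iota (F i) x) =
  sqint D mu (iota (\sum_(i <- r) k i *: F i)).
Proof.
apply: sqint_ae_eq => //.
  apply: measurable_complex_sum => i.
  by apply: measurable_complexM => //; exact: measurable_complex_cst.
by apply: filterS (iota_sum r k F) => x + Dx => /(_ Dx) ->.
Qed.

Section kernel.
Variable J : nat.
Implicit Types u v : 'I_J -> V.

(** [Cov] over an abstract measure space; for [iU] both unfold to the same expression. *)
Definition cov_kernel u v (p : T * T) : R[i] :=
  J%:R^-1 * \sum_(j < J) iota (u j) p.1 * (iota (v j) p.2)^*.

Lemma measurable_complex_fst (g : T -> R[i]) : measurable_complex D g ->
  measurable_complex (D `*` D) (fun p : T * T => g p.1).
Proof.
move=> [rg jg]; split.
  apply: (@measurable_comp _ _ _ _ _ _ D (fun x => complex.Re (g x)) (D `*` D) fst) => //.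
    by move=> _ [[x y] [Dx Dy] <-].
  exact: measurable_funTS.
apply: (@measurable_comp _ _ _ _ _ _ D (fun x => complex.Im (g x)) (D `*` D) fst) => //.
  by move=> _ [[x y] [Dx Dy] <-].
exact: measurable_funTS.
Qed.

Lemma measurable_complex_snd (g : T -> R[i]) : measurable_complex D g ->
  measurable_complex (D `*` D) (fun p : T * T => g p.2).
Proof.
move=> [rg jg]; split.
  apply: (@measurable_comp _ _ _ _ _ _ D (fun x => complex.Re (g x)) (D `*` D) snd) => //.
    by move=> _ [[x y] [Dx Dy] <-].
  exact: measurable_funTS.
apply: (@measurable_comp _ _ _ _ _ _ D (fun x => complex.Im (g x)) (D `*` D) snd) => //.
  by move=> _ [[x y] [Dx Dy] <-].
exact: measurable_funTS.
Qed.

Lemma measurable_cov_kernel u v : measurable_complex (D `*` D) (cov_kernel u v).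
Proof.
apply: measurable_complexM; first exact: measurable_complex_cst.
apply: measurable_complex_sum => j; apply: measurable_complexM.
  exact: measurable_complex_fst.
exact/measurable_complex_conj/measurable_complex_snd.
Qed.

(** Tonelli: for fixed second variable [y], the kernel is almost everywhere in [x] the image under
    [iota] of one vector of [V], whose squared norm is bounded by [H y]. *)
Lemma sqint_cov_kernel_le u v (H : T -> \bar R) :
  (forall y, D y -> (0 <= H y)%E) -> measurable_fun D H ->
  (forall y, D y -> (sqint D mu (iota
     (\sum_j (J%:R^-1 * (iota (v j) y)^*) *: u j)%R) <= H y)%E) ->
  (sqint (D `*` D) (mu \x mu)%E (cov_kernel u v) <= \int[mu]_(y in D) H y)%E.
Proof.
move=> H0 mH uvH; rewrite /sqint integral_mkcond.
set g := (_ \_ _).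
have mg : measurable_fun setT g.
  apply/(measurable_restrictT _ (measurableX mD mD)).
  exact/measurable_normc_sqr/measurable_cov_kernel.
have g0 p : (0 <= g p)%E.
  by rewrite /g patchE; case: ifPn => // _; rewrite lee_fin sqr_ge0.
rewrite fubini_tonelli2//; rewrite [leRHS]integral_mkcond.
apply: ge0_le_integral => //.
- by move=> y _; exact: integral_ge0.
- exact: measurable_fun_fubini_tonelli_G.
- by apply/(measurable_restrictT _ mD).
move=> y _; rewrite patchE /fubini_G; case: ifPn => [|nDy]; last first.
  rewrite integral0_eq// => x _; rewrite /g patchE ifN//.
  by apply: contra nDy; rewrite !inE => -[].
rewrite inE => Dy; apply: le_trans (uvH _ Dy); rewrite -sqint_sum /sqint.
rewrite [leRHS]integral_mkcond le_eqVlt; apply/orP; left; apply/eqP.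
apply: eq_integral => x _; rewrite /g !patchE.
have [Dx|nDx] := boolP (x \in D); last first.
  by rewrite ifN//; apply: contra nDx; rewrite !inE => -[].
rewrite ifT; last by rewrite inE; split => //=; rewrite -inE.
congr (_ ^+ 2)%:E; congr normc; rewrite /cov_kernel mulr_sumr; apply: eq_bigr => j _ /=.
by rewrite -mulrA [X in _ = _ * X]mulrC.
Qed.

End kernel.

Variables (dot : {dot W for Num.conj}) (E : set W).
Hypothesis dotE : norm_from_dot dot.
Hypothesis basisE : orthonormal_basis dot E.

(** No factor [J] appears, because the sum over [j] is kept inside [A] and [B]: [A] is estimated on
    slices at fixed [y], and [B] after integrating each basis coefficient over [y]. *)
Lemma cov_kernel_bound (J : nat) (f : 'I_J -> antidual W)
    (A B : antidual W -> V) (a b : R) :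
  linear A -> linear B ->
  (forall l, normR (A l) <= a * dual_norm l) ->
  (forall l, normR (B l) <= b * dual_norm l) ->
  (sqint (D `*` D) (mu \x mu)%E (cov_kernel (A \o f) (B \o f)) <=
   ((c * a * (c * b) * hs_norm E (Pi_f f)) ^+ 2)%:E)%E.
Proof.
move=> lA lB Aa Bb.
have sqb (O : antidual W -> V) o l : (forall l, normR (O l) <= o * dual_norm l) ->
    (sqint D mu (iota (O l)) <= ((c * o) ^+ 2 * dual_norm l ^+ 2)%:E)%E.
  move=> Oo; apply: (le_trans (iota_bounded _)); rewrite lee_fin -[leRHS]exprMn -mulrA.
  rewrite [leLHS]exprMn [leRHS]exprMn ler_wpM2l ?sqr_ge0// ler_sqr ?nnegrE ?normR_ge0//.
  exact: le_trans (normR_ge0 _) (Oo l).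
pose k y j := J%:R^-1 * (iota (B (f j)) y)^*.
set S := (\sum_j (c * normR (J%:R^-1 *: B (f j))) ^+ 2).
have S0 : 0 <= S by apply: sumr_ge0 => j _; exact: sqr_ge0.
have mk j : measurable_complex D (k ^~ j).
  apply: measurable_complexM; first exact: measurable_complex_cst.
  exact: measurable_complex_conj.
apply/lee_addgt0Pr => eps eps0.
(* Chosen so that the tail, multiplied by [(c * a) ^+ 2] and integrated to at most [S], stays below
   [eps]; [+ 1] guards against a zero denominator. *)
have eta0 : 0 < eps / ((c * a) ^+ 2 * S + 1).
  by rewrite divr_gt0// ltr_wpDl// mulr_ge0// sqr_ge0.
have [s [us sE fs]] := dual_norm_comb_tail dotE basisE f eta0.
set eta := (eps / _) in eta0 fs.
(* Measurable majorant of the slices: finitely many basis coefficients plus the tail. *)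
pose H y := (((c * a) ^+ 2)%:E * (\sum_(e <- s) (normc (\sum_j k y j * f j e) ^+ 2)%:E
   + eta%:E * \sum_j (normc (k y j) ^+ 2)%:E))%E.
have m1 e : measurable_complex D (fun y => \sum_j k y j * f j e).
  apply: measurable_complex_sum => j; apply: measurable_complexM (mk j) _.
  exact: measurable_complex_cst.
have H0 y : D y -> (0 <= H y)%E.
  move=> _; rewrite mule_ge0 ?lee_fin ?sqr_ge0// adde_ge0 ?sume_ge0//.
    by move=> e _; rewrite lee_fin sqr_ge0.
  by rewrite mule_ge0 ?lee_fin ?(ltW eta0)// sume_ge0// => j _; rewrite lee_fin sqr_ge0.
have ms1 : measurable_fun D
    (fun y => \sum_(e <- s) (normc (\sum_j k y j * f j e) ^+ 2)%:E)%E.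
  by apply: emeasurable_sum => e; exact: measurable_normc_sqr.
have ms2 : measurable_fun D (fun y => \sum_j (normc (k y j) ^+ 2)%:E)%E.
  by apply: emeasurable_sum => j; exact: measurable_normc_sqr.
have ms3 : measurable_fun D (fun y => eta%:E * \sum_j (normc (k y j) ^+ 2)%:E)%E.
  exact: measurable_funeM.
have p1 y : (0 <= \sum_(e <- s) (normc (\sum_j k y j * f j e) ^+ 2)%:E)%E.
  by apply: sume_ge0 => e _; rewrite lee_fin sqr_ge0.
have p2 y : (0 <= \sum_j (normc (k y j) ^+ 2)%:E)%E.
  by apply: sume_ge0 => e _; rewrite lee_fin sqr_ge0.
have p3 y : (0 <= eta%:E * \sum_j (normc (k y j) ^+ 2)%:E)%E.
  by rewrite mule_ge0// lee_fin ltW.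
apply: (@le_trans _ _ (\int[mu]_(y in D) H y)%E).
  apply: sqint_cov_kernel_le => //.
    by apply: measurable_funeM; exact: emeasurable_funD.
  move=> y Dy; rewrite /= -[X in iota X](linear_prop_sum _ (k y))//.
  apply: (le_trans (sqb _ _ _ Aa)); rewrite /H EFinM lee_wpmul2l ?lee_fin ?sqr_ge0//.
  rewrite !sumEFin -EFinM -EFinD lee_fin; apply: (le_trans (fs (k y))).
  by rewrite lerD2r /coef_sqsum; apply: ler_sum => e _; rewrite antidual_sum.
rewrite ge0_integralZl//; last 3 first.
- exact: emeasurable_funD.
- by move=> y _; rewrite adde_ge0.
- by rewrite lee_fin sqr_ge0.
rewrite ge0_integralD// ge0_integralZl// ?lee_fin ?(ltW eta0)//.
rewrite ge0_integral_sum//; last 2 first.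
- by move=> e; exact: measurable_normc_sqr.
- by move=> e y _; rewrite lee_fin sqr_ge0.
rewrite ge0_integral_sum//; last 2 first.
- by move=> j; exact: measurable_normc_sqr.
- by move=> j y _; rewrite lee_fin sqr_ge0.
have b1 : (\sum_(e <- s) \int[mu]_(y in D) (normc (\sum_j k y j * f j e) ^+ 2)%:E <=
    ((c * b) ^+ 2 * hs_norm E (Pi_f f) ^+ 2)%:E)%E.
  apply: (@le_trans _ _ (\sum_(e <- s) ((c * b) ^+ 2 * dual_norm (Pi_f f e) ^+ 2)%:E)%E).
    apply: lee_sum => e _; apply: le_trans (sqb _ _ _ Bb).
    rewrite Pi_f_comb linear_prop_sum// -sqint_sum /sqint.
    rewrite le_eqVlt; apply/orP; left; apply/eqP.
    apply: eq_integral => y _; congr (_ ^+ 2)%:E.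
    (* Both [k y j] and [pairing] carry a conjugate, so the coefficient at [e] is the conjugate of
       the value at [y] of the image of [B (Pi_f f e)]. *)
    rewrite -normc_conj rmorph_sum/=; congr normc; apply: eq_bigr => j _.
    rewrite /k !(rmorphM Num.conj)/= conjCK /pairing -mulrA [X in _ * X = _]mulrC mulrA.
    by rewrite fmorphV rmorph_nat.
  rewrite sumEFin lee_fin -mulr_sumr ler_wpM2l ?sqr_ge0//.
  exact: (sum_dual_norm_Pi_f_le_hs_norm dotE basisE).
have b2 : (\sum_j \int[mu]_(y in D) (normc (k y j) ^+ 2)%:E <= S%:E)%E.
  rewrite /S -sumEFin; apply: lee_sum => j _; apply: le_trans (iota_bounded _).
  (* As a one-term sum, so that [sqint_sum] supplies the almost everywhere homogeneity of [iota]. *)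
  have -> : J%:R^-1 *: B (f j) = \sum_(i <- [:: j]) J%:R^-1 *: B (f i).
    by rewrite big_seq1.
  rewrite -sqint_sum /sqint le_eqVlt; apply/orP; left; apply/eqP.
  apply: eq_integral => y _; congr (_ ^+ 2)%:E.
  by rewrite big_seq1 /k !Normc.normcM normc_conj.
have q0 : (0 <= ((c * a) ^+ 2)%:E :> \bar R)%E by rewrite lee_fin sqr_ge0.
apply: (le_trans (lee_wpmul2l q0 (leeD b1 (lee_wpmul2l _ b2)))).
  by rewrite lee_fin ltW.
have e1 : eta * ((c * a) ^+ 2 * S + 1) = eps.
  by rewrite /eta divfK// gt_eqF// ltr_wpDl// mulr_ge0// sqr_ge0.
clearbody eta.
have e2 : (c * a) ^+ 2 * ((c * b) ^+ 2 * hs_norm E (Pi_f f) ^+ 2 + eta * S) <=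
    (c * a * (c * b) * hs_norm E (Pi_f f)) ^+ 2 + eps.
  rewrite -[X in _ <= _ + X]e1 -exprMn mulrDr -exprMn !mulrA lerD2l.
  by have := eta0; move: (eta) (S) ((c * a) ^+ 2) => x y z x0; lra.
exact: e2.
Qed.

End covariance_bound.

(** * Linearization error *)

Section product_ae.
Context d (T : measurableType d) (R : realType).
Variables (mu : {sigma_finite_measure set T -> \bar R}).

(** A cylinder over a null set is null even when [mu setT] is infinite, since [0 * +oo = 0]. *)
Lemma ae_fst (P : set T) : {ae mu, forall x, P x} ->
  {ae (mu \x mu)%E, forall p, P p.1}.
Proof.
move=> [N [mN N0 PN]]; exists (N `*` setT); split.
- exact: measurableX.
- by rewrite product_measure1E// [X in (X * _)%E]N0 mul0e.
- by move=> [x y] /= nP; split => //; exact: PN.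
Qed.

Lemma ae_snd (P : set T) : {ae mu, forall x, P x} ->
  {ae (mu \x mu)%E, forall p, P p.2}.
Proof.
move=> [N [mN N0 PN]]; exists (setT `*` N); split.
- exact: measurableX.
- by rewrite product_measure1E// [X in (_ * X)%E]N0 mule0.
- by move=> [x y] /= nP; split => //; exact: PN.
Qed.

End product_ae.

Section linearization.
Context d (T : measurableType d) (R : realType).
Variables (mu : {sigma_finite_measure set T -> \bar R}) (D : set T).
Hypothesis mD : measurable D.
Variables (V : completeNormedModType R[i]) (iota : V -> T -> R[i]).
Hypothesis miota : forall v, measurable_complex D (iota v).
Hypothesis iota_linear : forall a u v,
  {ae mu, forall x, D x -> iota (a *: u + v) x = a * iota u x + iota v x}.
Variables (J : nat) (u v phi : 'I_J -> V).
Local Notation Cov := (cov_kernel iota).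

Lemma iota_sub a b : {ae mu, forall x, D x -> iota (a - b) x = iota a x - iota b x}.
Proof.
apply: filterS (iota_linear (-1) b a) => x + Dx => /(_ Dx).
by rewrite scaleN1r addrC => ->; rewrite mulN1r addrC.
Qed.

Lemma ae_forall_ord (P : 'I_J -> set T) : (forall j, {ae mu, forall x, P j x}) ->
  {ae mu, forall x, forall j, P j x}.
Proof. by move=> aeP; apply: filter_forall. Qed.

Let w j := u j - v j - phi j.

(** Expanding [v = u - (u - v)] gives the terms linear in [u - v = phi + w] minus a quadratic one,
    whose sign is moved into its first slot to leave a sum of three kernels. *)
Lemma linearization_error_ae :
  {ae (mu \x mu)%E, forall p, (D `*` D) p ->
    Cov u u p - Cov v v p - (Cov u phi p + Cov phi u p) =
    Cov u w p + Cov w u p + Cov (fun j => v j - u j) (fun j => u j - v j) p}.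
Proof.
have H : {ae mu, forall x j, D x -> [/\ iota (u j - v j) x = iota (u j) x - iota (v j) x,
    iota (v j - u j) x = iota (v j) x - iota (u j) x &
    iota (w j) x = iota (u j) x - iota (v j) x - iota (phi j) x]}.
  apply: ae_forall_ord => j.
  apply: filterS3 (iota_sub (u j) (v j)) (iota_sub (v j) (u j))
    (iota_sub (u j - v j) (phi j)) => x h1 h2 h3 Dx.
  by split; [exact: h1|exact: h2|rewrite /w h3// h1].
apply: filterS2 (ae_fst H) (ae_snd H) => -[x y] /= hx hy [/= Dx Dy].
rewrite /cov_kernel -!mulrDr -!mulrBr -!big_split/= -!sumrB; congr (_ * _).
apply: eq_bigr => j _.
have [_ -> ->] := hx j Dx; have [-> _ ->] := hy j Dy.
by rewrite !rmorphB; ring.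
Qed.

Lemma sqint_linearization_error :
  (sqint (D `*` D) (mu \x mu)%E
     (fun p => (Cov u u p - Cov v v p - (Cov u phi p + Cov phi u p))%R) <=
   3%:E * (sqint (D `*` D) (mu \x mu)%E (Cov u w) +
           sqint (D `*` D) (mu \x mu)%E (Cov w u) +
           sqint (D `*` D) (mu \x mu)%E
             (Cov (fun j => v j - u j)%R (fun j => u j - v j)%R)))%E.
Proof.
have mC (a b : 'I_J -> V) : measurable_complex (D `*` D) (Cov a b).
  exact: measurable_cov_kernel.
rewrite (sqint_ae_eq _ _ _ linearization_error_ae).
- by apply: sqint_add3 => //; exact: measurableX.
- exact: measurableX.
- have mN f : measurable_complex (D `*` D) f ->
      measurable_complex (D `*` D) (fun p => - f p).
    move=> mf; under eq_fun do rewrite -mulN1r.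
    by apply: measurable_complexM => //; exact: measurable_complex_cst.
  by do !apply: measurable_complexD => //; apply: mN => //; apply: measurable_complexD.
- by do !apply: measurable_complexD.
Qed.

End linearization.

(** * Perturbation of the inverse operator in the parameter *)

Section affine_bilinear_model.
Variables (R : realType) (X : completeNormedModType R).
Variables (U W : completeNormedModType R[i]).
Variables (K : U -> antidual W) (B : U -> X -> antidual W).
Hypothesis KB : affine_bilinear K B.

Local Notation Dop := (Dop K B).
Local Notation Dinv := (Dinv K B).

Lemma Dop_linear theta : linear (Dop theta).
Proof.
move=> a u v; rewrite /Defs.Dop (K_linear KB) (B_linear KB).
by rewrite scalerDr addrACA.
Qed.

Lemma B_realD u h k : B u (h + k) = B u h + B u k.
Proof. by have := B_real_linear KB u 1 h k; rewrite !scale1r. Qed.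

Lemma DopB theta theta0 u :
  Dop theta u - Dop theta0 u = B u (theta - theta0).
Proof.
rewrite /Defs.Dop opprD addrACA subrr add0r -[in LHS](subrK theta0 theta).
by rewrite (B_realD _ (theta - theta0)) addrK.
Qed.

Lemma B_subl u v h : B (u - v) h = B u h - B v h.
Proof.
have := B_linear KB h (-1) v u; rewrite !scaleN1r.
by rewrite [u - v]addrC => ->; rewrite addrC.
Qed.

Section invertible.
Variable theta : X.
Hypothesis bij : bijective (Dop theta).

(** Bijectivity rules out the default value 0 of [xget]. *)
Lemma DinvK l : Dop theta (Dinv theta l) = l.
Proof.
have [g _ gK] := bij.
by apply: (@xgetPex _ _ [set u | Dop theta u = l]); exists (g l); exact: gK.
Qed.

Lemma Dinv_eq u l : Dop theta u = l -> Dinv theta l = u.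
Proof. by move=> ul; apply: (bij_inj bij); rewrite DinvK. Qed.

Lemma Dinv_linear : linear (Dinv theta).
Proof. by move=> a l l'; apply: Dinv_eq; rewrite Dop_linear !DinvK. Qed.

Lemma DinvB l l' : Dinv theta (l - l') = Dinv theta l - Dinv theta l'.
Proof. by rewrite addrC -scaleN1r Dinv_linear scaleN1r addrC. Qed.

Lemma DinvN l : Dinv theta (- l) = - Dinv theta l.
Proof.
by rewrite -[- l]addr0 -scaleN1r Dinv_linear (linear_prop0 Dinv_linear) scaleN1r
  addr0.
Qed.

End invertible.

Variables (theta theta0 : X) (P b : R).
Hypothesis bij : bijective (Dop theta).
Hypothesis bij0 : bijective (Dop theta0).
Hypothesis P0 : 0 <= P.
Hypothesis b0 : 0 <= b.
Hypothesis DinvP : forall l, normR (Dinv theta l) <= P * dual_norm l.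
Hypothesis DinvP0 : forall l, normR (Dinv theta0 l) <= P * dual_norm l.
Hypothesis Bb : forall u h, dual_norm (B u h) <= b * normR u * `|h|.

Let h := theta - theta0.

(** Second resolvent identity: the inverse at [theta] is applied to the difference of the operators,
    which is [B] in direction [h] as [K] cancels. *)
Lemma Dinv_diff l :
  Dinv theta l - Dinv theta0 l = - Dinv theta (B (Dinv theta0 l) h).
Proof.
rewrite -[X in _ - X](Dinv_eq bij (erefl _)) -DinvB// -DinvN//; congr Dinv.
by rewrite -/h -(DopB theta theta0) DinvK// opprB.
Qed.

Lemma normR_DinvB u : normR (Dinv theta (B u h)) <= P * b * `|h| * normR u.
Proof.
apply: (le_trans (DinvP _)); rewrite -!mulrA ler_wpM2l//.
by rewrite [`|h| * _]mulrC mulrA Bb.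
Qed.

Lemma normR_Dinv_diff l :
  normR (Dinv theta l - Dinv theta0 l) <= P * b * `|h| * P * dual_norm l.
Proof.
rewrite Dinv_diff normRN; apply: (le_trans (normR_DinvB _)).
by rewrite -[leRHS]mulrA ler_wpM2l// !mulr_ge0.
Qed.

(** First-order Taylor remainder of the solution map, with the derivative taken at the new point
    [theta]. *)
Definition Dinv_remainder l : U :=
  Dinv theta l - Dinv theta0 l - Dinv theta (- B (Dinv theta l) h).

(** The resolvent identity has the solution at [theta0] under [B], the derivative the one at
    [theta]; their difference is again of first order, so the remainder is of second order in
    [h]. *)
Lemma Dinv_remainderE l :
  Dinv_remainder l = Dinv theta (B (Dinv theta l - Dinv theta0 l) h).
Proof.
rewrite /Dinv_remainder {1}Dinv_diff DinvN// opprK B_subl DinvB// addrC//.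
Qed.

Lemma normR_Dinv_remainder l : normR (Dinv_remainder l) <=
  P * b * `|h| * (P * b * `|h| * P) * dual_norm l.
Proof.
rewrite Dinv_remainderE; apply: (le_trans (normR_DinvB _)).
rewrite -[leRHS]mulrA ler_wpM2l ?normR_Dinv_diff// !mulr_ge0//.
Qed.

Lemma Dinv_diff_linear : linear (fun l => Dinv theta l - Dinv theta0 l).
Proof.
by move=> a l l'; rewrite !Dinv_linear// scalerBr opprD addrACA.
Qed.

Lemma Dinv_remainder_linear : linear Dinv_remainder.
Proof.
move=> a l l'; rewrite !Dinv_remainderE Dinv_diff_linear (B_linear KB).
exact: Dinv_linear.
Qed.

End affine_bilinear_model.

(** * Uniform bounds on balls, and the final estimate *)

Lemma bounded_to_bounded_bound (R : realType) (pi : R -> R) : bounded_to_bounded pi ->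
  exists P : R -> R -> R, (forall a r, 0 <= P a r) /\
    forall a r t, 0 <= t <= a + r -> pi t <= P a r.
Proof.
move=> [_ pib].
have /choice[P HP] : forall ar : R * R, exists M : R, 0 <= M /\
    forall t, 0 <= t <= ar.1 + ar.2 -> pi t <= M.
  move=> [a r] /=; have [] := pib [set t | 0 <= t <= a + r].
  - by move=> t /= /andP[].
  - exists `|a + r|; split; first exact: num_real.
    move=> M aM t /= /andP[t0 tar]; rewrite ger0_norm//.
    by rewrite (le_trans tar)// (le_trans (ler_norm _))// ltW.
  (* Boundedness is stated for every real strictly above [M], hence [M + 1]. *)
  move=> M [_ HM]; exists `|M + 1|; split => // t tar.
  apply: (le_trans (ler_norm _)).
  by apply: le_trans (HM (M + 1) _ _ _) (ler_norm _); [rewrite ltrDl|exists t].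
exists (fun a r => P (a, r)); split => [a r|a r t]; first by have [] := HP (a, r).
by have [_] := HP (a, r); apply.
Qed.

Theorem theorem5p7 (R : realType) (n : nat) (Omega : set 'rV[R]_n.+1)
    (X : completeNormedModType R) (U W : completeNormedModType R[i])
    (dotW : {dot W for Num.conj})
    (iU : U -> 'rV[R]_n.+1 -> R[i]) (iW : W -> 'rV[R]_n.+1 -> R[i])
    (K : U -> antidual W) (B : U -> X -> antidual W) (Dom : set X)
    (Xh : completeNormedModType R) (Uh : completeNormedModType R[i])
    (jX : Xh -> X) (jU : Uh -> U) :
  smooth_domain Omega ->
  real_hilbert X -> complex_hilbert U -> norm_from_dot dotW ->
  gelfand_triple Omega iU -> gelfand_triple Omega iW ->
  affine_bilinear K B ->
  (forall theta, Dom theta -> boundedly_invertible K B theta) ->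
  bounded_inverse_assumption K B Dom ->
  lifted_regularity K B Omega iU iW Dom jX jU ->
  exists (Mh : R -> R -> R) (Nh : R -> R -> R -> R),
    [/\ forall a r, 0 < Mh a r, forall a r p, 0 < Nh a r p &
      forall (J : nat) (f : 'I_J -> antidual W) (E : set W)
             (theta0 : Xh) (rho : R),
        (0 < J)%N -> orthonormal_basis dotW E -> 0 < rho ->
        ball theta0 rho `<=` jX @^-1` Dom ->
        forall theta : Xh, ball theta0 rho theta ->
          let norm2 :=
            L2norm (lebesgue_rV R n.+1 \x lebesgue_rV R n.+1)%E
                   (Omega `*` Omega) in
          let F := Fmap K B iU f \o jX in
          let h := theta - theta0 in
          let dF p := F theta p - F theta0 p in
          let Elin := norm2 (fun p =>
            dF p - Fderiv K B iU f (jX theta) (jX h) p) in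
          (Elin <= (Mh `|theta0| rho * `|h|)%:E * norm2 dF
                   + (Nh `|theta0| rho (hs_norm E (Pi_f f))
                        * `|jX h| * `|h|)%:E)%E].
Proof.
move=> [oOmega _ _ _] _ _ dotE gU _ KB binv [pi [pibb pi_le]] lifted.
have mO : measurable Omega by exact: open_measurable_rV.
have [P [Pge0 Ple]] := bounded_to_bounded_bound pibb.
have [c cU] := gelfand_continuous gU.
have [b bB] := B_bounded KB.
have Bb u h : dual_norm (B u h) <= `|b| * normR u * `|h|.
  by rewrite (le_trans (bB u h))// ler_wpM2r// ler_wpM2r ?normR_ge0// ler_norm.
have miU v : measurable_complex Omega (iU v) by have [] := gelfand_L2 gU v.
have iUb v : (sqint Omega (lebesgue_rV R n.+1) (iU v) <= ((`|c| * normR v) ^+ 2)%:E)%E.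
  apply/L2norm_le => //; first by rewrite mulr_ge0// normR_ge0.
  by rewrite (le_trans (cU v))// lee_fin ler_wpM2r ?normR_ge0// ler_norm.
(* Each of the three covariance terms contributes two factors [|c|], two factors [|b|] and four
   bounds on an inverse; [3] is the root of 3 terms times the 3 of [sqint_add3]. *)
pose C a r := 3 * `|c| ^+ 2 * `|b| ^+ 2 * P a r ^+ 4.
have C0 a r : 0 <= C a r by rewrite !mulr_ge0 ?exprn_ge0.
(* The modulus and [+ 1] make the second constant positive for every real [p]. *)
exists (fun _ _ => 1), (fun a r p => C a r * `|p| + 1); split => //.
  by move=> a r p; rewrite ltr_wpDl// mulr_ge0.
move=> J f E theta0 rho J0 basisE rho0 ballD theta btheta.
cbv zeta; set Elin := (X in (X <= _)%E); set h := theta - theta0.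
have jXB : jX theta - jX theta0 = jX h.
  have := lifted_jX_linear lifted (-1) theta0 theta; rewrite !scaleN1r.
  by rewrite /h [theta - _]addrC => ->; rewrite addrC.
have Dtheta0 : Dom (jX theta0) by apply: ballD; exact: ballxx.
have Dtheta : Dom (jX theta) by exact: ballD.
have [bij _] := binv _ Dtheta; have [bij0 _] := binv _ Dtheta0.
(* One bound for both inverses: [jX] does not increase norms, and [theta], [theta0] have norm at
   most the norm of [theta0] plus [rho]. *)
set Q := P `|theta0| rho; have Q0 : 0 <= Q by exact: Pge0.
have thetaQ : pi `|jX theta| <= Q.
  apply: Ple; rewrite normr_ge0/= (le_trans (lifted_jX_le lifted _))//.
  rewrite -(subrK theta0 theta) (le_trans (ler_normD _ _))// addrC lerD2l.
  by rewrite ltW// distrC; move: btheta; rewrite -ball_normE.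
have theta0Q : pi `|jX theta0| <= Q.
  apply: Ple; rewrite normr_ge0/= (le_trans (lifted_jX_le lifted _))//.
  by rewrite lerDl ltW.
have DinvQ l : normR (Dinv K B (jX theta) l) <= Q * dual_norm l.
  by rewrite (le_trans (pi_le _ Dtheta l))// ler_wpM2r// dual_norm_ge0.
have DinvQ0 l : normR (Dinv K B (jX theta0) l) <= Q * dual_norm l.
  by rewrite (le_trans (pi_le _ Dtheta0 l))// ler_wpM2r// dual_norm_ge0.
set hs := hs_norm E (Pi_f f).
have hs0 : 0 <= hs by exact: sqrtr_ge0.
set q := Q * `|b| * `|jX h|; have q0 : 0 <= q by rewrite !mulr_ge0.
have ElinC : (Elin <= (C `|theta0| rho * hs * `|jX h| ^+ 2)%:E)%E.
  apply/L2norm_le; first by rewrite !mulr_ge0// sqr_ge0.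
  have := sqint_linearization_error mO miU (gelfand_linear gU)
    (Sol K B f (jX theta)) (Sol K B f (jX theta0))
    (fun j => Dinv K B (jX theta) (- B (Sol K B f (jX theta) j) (jX h))).
  move=> /le_trans; apply.
  have covb := cov_kernel_bound mO miU (gelfand_linear gU) iUb dotE basisE f.
  pose Au := Dinv K B (jX theta).
  pose Aw := Dinv_remainder K B (jX theta) (jX theta0).
  pose Ad l := Dinv K B (jX theta) l - Dinv K B (jX theta0) l.
  pose Ad' l := Dinv K B (jX theta0) l - Dinv K B (jX theta) l.
  have lAu : linear Au by exact: Dinv_linear.
  have lAw : linear Aw by exact: Dinv_remainder_linear.
  have lAd : linear Ad by exact: Dinv_diff_linear.
  have lAd' : linear Ad' by exact: Dinv_diff_linear.
  have bAw l : normR (Aw l) <= q * (q * Q) * dual_norm l.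
    by rewrite /q -jXB; exact: normR_Dinv_remainder.
  have bAd l : normR (Ad l) <= q * Q * dual_norm l.
    by rewrite /q -jXB; exact: normR_Dinv_diff.
  have bAd' l : normR (Ad' l) <= q * Q * dual_norm l.
    by rewrite -normRN opprB; exact: bAd.
  have c1 := covb Au Aw _ _ lAu lAw DinvQ bAw.
  have c2 := covb Aw Au _ _ lAw lAu bAw DinvQ.
  have c3 := covb Ad' Ad _ _ lAd' lAd bAd' bAd.
  rewrite -/hs in c1 c2 c3.
  rewrite -jXB.
  apply: (@le_trans _ _ (3%:E * (((`|c| * Q * (`|c| * (q * (q * Q))) * hs) ^+ 2)%:E +
    ((`|c| * (q * (q * Q)) * (`|c| * Q) * hs) ^+ 2)%:E +
    ((`|c| * (q * Q) * (`|c| * (q * Q)) * hs) ^+ 2)%:E))%E).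
    by apply: lee_wpmul2l => //; apply: leeD; [apply: leeD|].
  rewrite -!EFinD -EFinM lee_fin le_eqVlt; apply/orP; left; apply/eqP.
  by rewrite jXB /C -/Q /q; ring.
rewrite (le_trans ElinC)//.
rewrite -[leLHS]add0e; apply: leeD.
  by rewrite mule_ge0 ?lee_fin ?mulr_ge0//; exact: Lnorm_ge0.
(* One of the two factors [|jX h|] is enlarged to [|h|]. *)
rewrite lee_fin expr2 mulrA ler_pM ?mulr_ge0//.
  by rewrite ler_wpM2r// ger0_norm// lerDl.
exact: lifted_jX_le lifted _.
Qed.
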